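(* Fix integers $d\ge 1$ and $M\ge 0$. There is a constant $C$ (depending only on $d$ and $M$) such that for every integer $N\ge 1$ there is an algorithm using at most $C N^{d+1}$ arithmetic operations which, given the degree-$N$ Bernstein coefficients of a polynomial $u\in P^N(\widehat D)$ and the degree-$M$ Bernstein coefficients of a polynomial $w\in P^M(\widehat D)$ on the reference simplex $\widehat D\subset\mathbb{R}^d$, outputs the degree-$N$ Bernstein coefficients of the $L^2(\widehat D)$-orthogonal projection of the product $uw\in P^{N+M}(\widehat D)$ onto $P^N(\widehat D)$.
   Context: The reference simplex is $\widehat D=\{x\in\mathbb{R}^d: x_i\ge -1 \ (1\le i\le d),\ \sum_{i=1}^d x_i\le 2-d\}$, with barycentric coordinates $\lambda_i=(1+x_i)/2$ for $1\le i\le d$ and $\lambda_0=1-\sum_{i=1}^d\lambda_i$. $P^N(\widehat D)$ is the space of real polynomials of total degree at most $N$ on $\widehat D$. For a multi-index $\bm{\alpha}=(\alpha_0,\dots,\alpha_d)$ of nonnegative integers with $|\bm{\alpha}|:=\sum_{i=0}^d\alpha_i=N$, the Bernstein basis function is $B^N_{\bm{\alpha}}=\frac{N!}{\alpha_0!\cdots\alpha_d!}\lambda_0^{\alpha_0}\cdots\lambda_d^{\alpha_d}$. The functions $\{B^N_{\bm{\alpha}}\}_{|\bm{\alpha}|=N}$ form a basis of $P^N(\widehat D)$, and the degree-$N$ Bernstein coefficients of $p\in P^N(\widehat D)$ are its coefficients in this basis. Computational model: operations are real additions and multiplications (a straight-line arithmetic program); real constants depending only on $d$, $N$, $M$ (not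 on the input coefficients) may be precomputed and are available at no cost. *)

(* Defs.v *)
(* Some notations of mpoly clash with those of MathComp-Analysis, hence the
   filtered import. *)
From HB Require Import structures.
From mathcomp Require Import all_boot all_order all_algebra.
From mathcomp Require Import -(notations) mpoly.
From mathcomp Require Import all_classical all_reals all_analysis.

Set Implicit Arguments.
Unset Strict Implicit.
Unset Printing Implicit Defensive.

Import Order.TTheory GRing.Theory Num.Theory.
Local Open Scope classical_set_scope.
Local Open Scope ring_scope.

Section LebesgueTuple.
Context (R : realType).
Local Notation T := (measurableTypeR R).

Definition cons_pair n (p : T * n.-tuple T) : n.+1.-tuple T :=
  [tuple of p.1 :: p.2].

Lemma measurable_cons_pair n : measurable_fun [set: _] (@cons_pair n).
Proof. exact: measurable_cons. Qed.

Section Step.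
Context (n : nat) (mu : {sigma_finite_measure set (n.-tuple T) -> \bar R}).

(* The product of the Lebesgue measure and mu, transported from R * R^n
   to R^(n+1). *)
Definition lebesgue_cons : set (n.+1.-tuple T) -> \bar R :=
  pushforward (@lebesgue_measure R \x mu)%E (@cons_pair n).

HB.instance Definition _ := Measure.copy lebesgue_cons
  (measure_function_pushforward__canonical__measure_function_Measure
     (@lebesgue_measure R \x mu)%E (@measurable_cons_pair n)).

Lemma lebesgue_cons_sigma_finite : sigma_finite setT lebesgue_cons.
Proof.
have /sigma_finiteP[F [TF ndF Foo]] := sigma_finiteT (@lebesgue_measure R).
have /sigma_finiteP[G [TG ndG Goo]] := sigma_finiteT mu.
pose split (t : n.+1.-tuple T) : T * n.-tuple T :=
  (tnth t ord0, [tuple of behead t]).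
have splitK : cancel (@cons_pair n) split.
  by case=> x t; congr pair => //; apply: val_inj.
have msplit : measurable_fun setT split.
  apply: measurable_fun_pair; first exact: measurable_tnth.
  exact: measurable_behead.
exists (fun k => split @^-1` (F k `*` G k)).
  apply/esym/seteqP; split=> // t _.
  have [k _ Fk] : (\bigcup_i F i) (split t).1 by rewrite -TF.
  have [l _ Gl] : (\bigcup_i G i) (split t).2 by rewrite -TG.
  exists (maxn k l) => //; split.
    by move: Fk; exact/subsetPset/ndF/leq_maxl.
  by move: Gl; exact/subsetPset/ndG/leq_maxr.
move=> k; have [mF F_fin] := Foo k; have [mG G_fin] := Goo k.
split.
  by rewrite -[X in measurable X]setTI; apply: msplit => //; exact: measurableX.
rewrite /lebesgue_cons /pushforward -comp_preimage.
rewrite (_ : split \o _ = id); last by apply/funext => p; exact: splitK.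
by rewrite preimage_id product_measure1E// lte_mul_pinfty// ge0_fin_numE.
Qed.

HB.instance Definition _ := @Measure_isSigmaFinite.Build _ _ _ lebesgue_cons
  lebesgue_cons_sigma_finite.

End Step.

(* The Lebesgue measure on R^n (the point mass when n = 0). *)
Fixpoint lebesgue_tuple n : {sigma_finite_measure set (n.-tuple T) -> \bar R} :=
  if n is n'.+1 then lebesgue_cons (lebesgue_tuple n') else dirac [tuple].

End LebesgueTuple.

Section ReferenceSimplex.
Context (R : realType) (d : nat).

Definition simplex : set (d.-tuple R) :=
  [set x | (forall i, -1 <= tnth x i) /\ \sum_i tnth x i <= 2 - d%:R].

Definition L2_inner (p q : mpoly d R) : \bar R :=
  (\int[lebesgue_tuple R d]_(x in simplex)
     (meval (tnth x) p * meval (tnth x) q)%:E)%E.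

(* P^N: total degree at most N, msize being one more than the degree. *)
Definition polys (N : nat) : set (mpoly d R) := [set p | (msize p <= N.+1)%N].

Definition is_L2_projection (N : nat) (f q : mpoly d R) : Prop :=
  polys N q /\ forall v, polys N v -> L2_inner (f - q) v = 0%E.

(* lambda_0 at index ord0, lambda_i at index lift ord0 i. *)
Definition barycentric (i : 'I_d.+1) : mpoly d R :=
  let lambda j := (2^-1 : R) *: (1 + mpolyX R (mnm1 j)) in
  if unlift ord0 i is Some j then lambda j else 1 - \sum_j lambda j.

End ReferenceSimplex.

(* Multi-indices (alpha_0, ..., alpha_d) with |alpha| = N; each component is
   at most N, so 'I_N.+1 loses nothing. *)
Definition multi_index (d N : nat) : finType :=
  {a : {ffun 'I_d.+1 -> 'I_N.+1} | (\sum_i a i == N :> nat)%N}.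

Definition bernstein (R : realType) d N (a : multi_index d N) : mpoly d R :=
  ((N`!)%:R / (\prod_i (val a i)`!)%:R : R) *:
    \prod_i barycentric R i ^+ val a i.

Definition is_bernstein_coeffs (R : realType) d N (p : mpoly d R)
    (c : multi_index d N -> R) : Prop :=
  p = \sum_a c a *: bernstein R a.

(* Straight-line programs over R, with inputs indexed by I and outputs by O.
   Result k is the value of the k-th gate; a gate referring to a value not yet
   computed reads 0, which is no more than a free constant. *)
Section StraightLine.
Context (R : nzRingType).

Inductive operand (I : Type) := Const of R | Input of I | Result of nat.

Inductive gate (I : Type) :=
  | Add of operand I & operand I
  | Mul of operand I & operand I.

Record slp (I O : Type) := Slp { gates : seq (gate I); output : O -> operand I }.

Definition slp_cost I O (P : slp I O) : nat := size (gates P).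

Definition operand_val I (x : I -> R) (vals : seq R) (o : operand I) : R :=
  match o with
  | Const c => c
  | Input i => x i
  | Result k => vals`_k
  end.

Definition gate_val I (x : I -> R) (vals : seq R) (g : gate I) : R :=
  match g with
  | Add a b => operand_val x vals a + operand_val x vals b
  | Mul a b => operand_val x vals a * operand_val x vals b
  end.

Definition slp_eval I O (P : slp I O) (x : I -> R) : O -> R :=
  let vals := foldl (fun vals g => rcons vals (gate_val x vals g)) [::] (gates P)
  in fun o => operand_val x vals (output P o).

End StraightLine.

Definition sum_input (R I J : Type) (x : I -> R) (y : J -> R) (k : I + J) : R :=
  match k with inl i => x i | inr j => y j end.

(* Main.v *)
(* Homogenise: the Bernstein coefficients of degree K of a polynomial are, up to
   multinomial factors, the coefficients of a form F of degree K in the barycentric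
   variables X_0, ..., X_d. Let s = \sum_i X_i and D = \sum_i d_i X_i d_i. Multiplying
   by s raises the Bernstein degree without changing the polynomial; D is, up to a
   scalar, the transpose of that operation. As D s = s D + 2K + d + 1 on forms of
   degree K, every form is a sum of terms s^k h with D h = 0, and D is diagonal on
   such chains.
   By Dirichlet's formula the integral over the simplex of a form of degree K is a
   multiple, depending only on K, of the functional X^a |-> a!; integration by parts
   shows that forms in the kernel of D are orthogonal to all forms of smaller degree.
   Hence on F of degree M + N the projection to degree N is \sum_j c_j s^j D^j (D^M F),
   where the constants c_j solve a triangular system. Every D or s costs O(N^d)
   operations, so Horner's scheme evaluates the sum in O(N^(d+1)). *)
Require Import Defs.
From HB Require Import structures.
From mathcomp Require Import all_boot all_order all_algebra.
From mathcomp Require Import -(notations) ssrcomplements mpoly.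
From mathcomp Require Import all_classical all_reals all_analysis measurable_realfun.
From mathcomp Require Import ring lra zify.

Set Implicit Arguments.
Unset Strict Implicit.
Unset Printing Implicit Defensive.

Import Order.TTheory GRing.Theory Num.Theory.
Import numFieldNormedType.Exports.
Local Open Scope ring_scope.

Local Notation "k .-homog" := (ishomog1 k mdeg) (at level 1, format "k .-homog").

(** * Forms and the lowering operator *)

Section Lowering.
Context (n : nat) (R : comNzRingType).
Implicit Types (F G : mpoly n R) (k m : multinom n).

Local Notation "''X_' i" := (mpolyX R (mnm1 i)).
Local Notation "p @_ m" := (mcoeff m p) (at level 3).
Local Notation "'\d_' i p" := (mderiv i p) (at level 10, i at level 2).

Definition varsum : mpoly n R := \sum_i 'X_i.

Definition lowering F : mpoly n R := \sum_i \d_i (\d_i F * 'X_i).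

Lemma mcoeffMX_lem F k m :
  (F * mpolyX R k)@_m = if mpoly.lem k m then F@_(mnm_sub m k) else 0.
Proof.
case: ifPn => [km|kNm]; first by rewrite -{1}(submK km) addmC mcoeffMX.
apply: memN_msupp_eq0; rewrite (perm_mem (msuppMX _ _)).
by apply/negP => /mapP[m' _ m'E]; move: kNm; rewrite m'E lem_addr.
Qed.

Lemma mcoeffMXU F i m :
  (F * 'X_i)@_m = if m i == 0%N then 0 else F@_(mnm_sub m (mnm1 i)).
Proof. by rewrite mcoeffMX_lem lep1mP; case: eqP. Qed.

(** In each variable, [\d_i X_i \d_i] turns [X_i^a] into [a^2 X_i^(a-1)]. Each coefficient of the
    result is thus a sum of [n] terms with constant weights; the operation count rests on this. *)
Lemma mcoeff_lowering F m :
  (lowering F)@_m = \sum_i (m i).+1%:R ^+ 2 * F@_(mnm_add m (mnm1 i)).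
Proof.
rewrite raddf_sum; apply: eq_bigr => i _ /=.
rewrite mcoeff_deriv addmC mcoeffMX mcoeff_deriv addmC.
by rewrite expr2 -mulrA !mulr_natl.
Qed.

Lemma mcoeff_varsumM F m :
  (varsum * F)@_m =
    \sum_i if m i == 0%N then 0 else F@_(mnm_sub m (mnm1 i)).
Proof.
rewrite mulr_suml raddf_sum; apply: eq_bigr => i _ /=.
by rewrite mulrC mcoeffMXU.
Qed.

Lemma lowering_is_linear : linear lowering.
Proof.
move=> c F G; rewrite /lowering scaler_sumr -big_split; apply: eq_bigr => i _ /=.
by rewrite !(mderivD, mderivZ, mulrDl) -mpoly_scaleAl mderivZ.
Qed.

HB.instance Definition _ :=
  GRing.isLinear.Build R (mpoly n R) (mpoly n R) *:%R lowering
    lowering_is_linear.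

Lemma dhomog_mcoeff K F :
  F \is K.-homog <-> forall m, mdeg m != K -> F@_m = 0.
Proof.
split=> [hF m|h]; first exact: dhomog_nemf_coeff.
apply/dhomogP => m; rewrite mcoeff_msupp; case: (mdeg m =P K) => // /eqP mK.
by rewrite h ?eqxx.
Qed.

Lemma lowering_homog K F : F \is K.+1.-homog -> lowering F \is K.-homog.
Proof.
move=> hF; apply/dhomog_mcoeff => m mK; rewrite mcoeff_lowering big1 // => i _.
by rewrite (dhomog_nemf_coeff hF) ?mulr0 //= mdegD mdeg1 addn1 eqSS.
Qed.

Lemma lowering_homog0 F : F \is 0.-homog -> lowering F = 0.
Proof.
move=> hF; apply/mpolyP => m; rewrite mcoeff_lowering mcoeff0 big1 // => i _.
by rewrite (dhomog_nemf_coeff hF) ?mulr0 //= mdegD mdeg1 addn1.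
Qed.

Lemma iter_lowering_homog j K F :
  F \is (j + K).-homog -> iter j lowering F \is K.-homog.
Proof. by elim: j F => // j IH F hF; rewrite iterSr; exact/IH/lowering_homog. Qed.

Lemma varsum_homog : varsum \is 1.-homog.
Proof. by apply: rpred_sum => i _; rewrite dhomogX /= mdeg1. Qed.

Lemma varsumM_homog K F : F \is K.-homog -> varsum * F \is K.+1.-homog.
Proof. exact: dhomogM varsum_homog. Qed.

Lemma varsumXM_homog (k : nat) K F :
  F \is K.-homog -> varsum ^+ k * F \is (k + K).-homog.
Proof.
by apply: dhomogM; have := dhomogMn k varsum_homog; rewrite mul1n.
Qed.

Lemma euler_homog K F : F \is K.-homog -> \sum_i \d_i F * 'X_i = K%:R *: F.
Proof.
move=> hF; apply/mpolyP => m; rewrite raddf_sum mcoeffZ /=.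
rewrite (eq_bigr (fun i => (m i)%:R * F@_m)) => [|i _].
  rewrite -mulr_suml -natr_sum -mdegE.
  by case: (mdeg m =P K) => [->//|/eqP/(dhomog_nemf_coeff hF)->]; rewrite !mulr0.
rewrite mcoeffMXU; case: eqP => [->|/eqP mi]; first by rewrite mul0r.
rewrite mcoeff_deriv submK ?lep1mP // mnmBE mnm1E eqxx subn1 prednK ?lt0n //.
by rewrite mulr_natl.
Qed.

Lemma mderivX_id i : \d_i ('X_i : mpoly n R) = 1.
Proof.
apply/mpolyP => m; rewrite mcoeff_deriv mcoeffX mcoeff1 -{1}[mnm1 i]add0m.
rewrite eqm_add2r eq_sym; case: eqP => [->|]; last by rewrite mul0rn.
by rewrite mnm0E.
Qed.

Lemma mderiv_varsum i : \d_i varsum = 1.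
Proof.
rewrite raddf_sum (bigD1 i) //= mderivX_id big1 ?addr0 // => j ji.
by rewrite mderivX mnm1E (negbTE ji) scale0r.
Qed.

(** As [\d_i s = 1], Leibniz's rule leaves [2 X_i \d_i F + F] for each variable, and Euler's
    identity sums these up. *)
Lemma lowering_varsumM K F : F \is K.-homog ->
  lowering (varsum * F) = varsum * lowering F + (K.*2 + n)%:R *: F.
Proof.
move=> hF; rewrite natrD scalerDl -mul2n natrM -scalerA -(euler_homog hF).
rewrite /lowering (eq_bigr (fun i => varsum * \d_i (\d_i F * 'X_i) +
    (\d_i F * 'X_i *+ 2 + F))) => [|i _].
  rewrite !big_split /= mulr_sumr sumr_const card_ord.
  by rewrite !scaler_nat mulr2n.
rewrite (mderivM i (varsum : mpoly n R)) mderiv_varsum mul1r.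
rewrite !(mderivM, mderivD) mderiv_varsum mderivX_id; ring.
Qed.

(** Moving [D] past the factors [s] one at a time adds up the scalars [2 (K + l) + n] for [l <= k];
    in the end [D] meets [F] and gives 0. *)
Lemma lowering_varsumX (k : nat) K F : F \is K.-homog -> lowering F = 0 ->
  lowering (varsum ^+ k.+1 * F) =
    (k.+1 * (K.*2 + n + k))%:R *: (varsum ^+ k * F).
Proof.
move=> hF F0; elim: k => [|k IH].
  by rewrite expr1 expr0 mul1r (lowering_varsumM hF) F0 mulr0 add0r mul1n addn0.
rewrite exprS -mulrA (lowering_varsumM (varsumXM_homog k.+1 hF)) IH.
rewrite -scalerAr mulrA -exprS -scalerDl -natrD; congr (_%:R *: _).
by rewrite -!mul2n; lia.
Qed.

End Lowering.

(** * Decomposition of forms into harmonic components *)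

Section Harmonic.
Context (n : nat) (R : numFieldType).
Implicit Types (F G : mpoly n.+1 R).

Local Notation s := (varsum n.+1 R).
Local Notation Dn := (@lowering n.+1 R).

(* sl_2 theory: on s^k h with h harmonic, D s is a nonzero scalar, so D s is onto,
   and every F is congruent to a harmonic polynomial modulo s. *)
Lemma homog_harmonic_ind K (P : mpoly n.+1 R -> Prop) :
  P 0 -> (forall F G, P F -> P G -> P (F + G)) ->
  (forall k i h, (k + i)%N = K -> h \is i.-homog -> Dn h = 0 ->
     P (s ^+ k * h)) ->
  forall F, F \is K.-homog -> P F.
Proof.
elim: K P => [|K IH] P P0 PD Ph F hF.
  by rewrite -[F]mul1r; apply: (Ph 0%N 0%N) => //; exact: lowering_homog0.
have [G hG DsG] : exists2 G, G \is K.-homog & Dn (s * G) = Dn F.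
  (* The induction hypothesis is applied to [D F], for the predicate of lying in the image of
     [D s]. *)
  apply: (IH (fun E => exists2 G, G \is K.-homog & Dn (s * G) = E)).
  - by exists 0; rewrite ?rpred0 // mulr0 raddf0.
  - move=> _ _ [G hG <-] [H hH <-]; exists (G + H); first exact: rpredD.
    by rewrite mulrDr raddfD.
  - move=> k i h kiK hh h0.
    have mu0 : (k.+1 * (i.*2 + n.+1 + k))%:R != 0 :> R.
      by rewrite pnatr_eq0 -lt0n muln_gt0 addnS.
    exists ((k.+1 * (i.*2 + n.+1 + k))%:R^-1 *: (s ^+ k * h)).
      by apply: rpredZ; rewrite -kiK; exact: varsumXM_homog.
    rewrite -scalerAr mulrA -exprS linearZ /= (lowering_varsumX k hh h0).
    by rewrite scalerA mulVf // scale1r.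
  - exact: lowering_homog.
(* [F - s G] is harmonic by the choice of [G]; for [s G] the induction hypothesis is used a second
   time, on [G]. *)
rewrite -[F](subrK (s * G)); apply: (PD).
  rewrite -[F - _]mul1r; apply: (Ph 0%N K.+1) => //.
    by apply: rpredB => //; exact: varsumM_homog.
  by rewrite raddfB /= DsG subrr.
apply: (IH (fun G => P (s * G))) => //; first by rewrite mulr0.
  by move=> A B PA PB; rewrite mulrDr; exact: PD.
move=> k i h kiK hh h0; rewrite mulrA -exprS; apply: Ph hh h0.
by rewrite addSn kiK.
Qed.

End Harmonic.

(** * The functional [X^a |-> a!] and integration by parts *)

Section FactorialFunctional.
Context (n : nat) (R : comNzRingType).
Implicit Types (F G : mpoly n R) (m : multinom n).

Local Notation "''X_' i" := (mpolyX R (mnm1 i)).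
Local Notation "'\d_' i p" := (mderiv i p) (at level 10, i at level 2).

Definition mfact m : nat := (\prod_i (m i)`!)%N.

(* On forms, [F |-> \int F(x) e^{-(x_1 + ... + x_n)} dx] over the positive orthant. *)
Definition factorial_functional F : R :=
  \sum_(m <- msupp F) mcoeff m F * (mfact m)%:R.

Local Notation Lam := factorial_functional.

(** Summing over all monomials of bounded degree removes the dependence on the support, so that
    linearity can be checked term by term. *)
Lemma factorial_functionalwE F k : (msize F <= k)%N ->
  Lam F = \sum_(m : bmultinom n k) mcoeff m F * (mfact m)%:R.
Proof.
move=> Fk; pose I : subFinType _ := bmultinom n k.
rewrite /Lam (big_mksub I) ?msupp_uniq //=; first last.
  by move=> m /msize_mdeg_lt /leq_trans; apply.
by rewrite big_rmcond //= => m /memN_msupp_eq0 ->; rewrite mul0r.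
Qed.

Lemma factorial_functional_is_scalar : scalar Lam.
Proof.
move=> c F G /=; pose k := maxn (msize (c *: F + G)) (maxn (msize F) (msize G)).
rewrite !(@factorial_functionalwE _ k) ?leq_max ?leqnn ?orbT //.
rewrite mulr_sumr -big_split; apply: eq_bigr => m _ /=.
by rewrite mcoeffD mcoeffZ mulrDl mulrA.
Qed.

HB.instance Definition _ :=
  GRing.isLinear.Build R (mpoly n R) R *%R Lam factorial_functional_is_scalar.

Lemma factorial_functionalX m : Lam (mpolyX R m) = (mfact m)%:R.
Proof. by rewrite /Lam msuppX big_seq1 mcoeffX eqxx mul1r. Qed.

Lemma mfactMU m i : mfact (mnm_add m (mnm1 i)) = ((m i).+1 * mfact m)%N.
Proof.
rewrite /mfact (bigD1 i) //= [in RHS](bigD1 i) //= mulnA.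
rewrite mnmDE mnm1E eqxx addn1 factS; congr (_ * _)%N.
by apply: eq_bigr => j ji; rewrite mnmDE mnm1E eq_sym (negbTE ji) addn0.
Qed.

(** On monomials this is [(m + e_i)! = (m_i + 1) m!]. For the exponential weight it is integration
    by parts, without boundary term since [G X_i] vanishes where [X_i = 0]. *)
Lemma factorial_functional_deriv i G : Lam (\d_i (G * 'X_i)) = Lam (G * 'X_i).
Proof.
elim/mpolyind: G => [|c m G _ _ IH]; first by rewrite mul0r !raddf0.
rewrite mulrDl !raddfD /= IH; congr (_ + _).
rewrite -scalerAl mderivZ !linearZ /= -mpolyXD mderivX addmK linearZ /=.
by rewrite !factorial_functionalX mfactMU natrM mnmDE mnm1E eqxx addn1.
Qed.

(** Each [F X_i] may be replaced by [\d_i (F X_i) = X_i \d_i F + F], and Euler's identity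
    applies. *)
Lemma factorial_functional_varsum K F : F \is K.-homog ->
  Lam (varsum n R * F) = (K + n)%:R * Lam F.
Proof.
move=> hF; rewrite mulrC mulr_sumr raddf_sum /=.
rewrite (eq_bigr (fun i => Lam (\d_i F * 'X_i + F))) => [|i _]; last first.
  by rewrite -factorial_functional_deriv mderivM mderivX_id mulr1.
rewrite -raddf_sum big_split /= (euler_homog hF) sumr_const card_ord.
by rewrite raddfD /= linearZ raddfMn /= natrD mulrDl !mulr_natl.
Qed.

(* Integration by parts: F D G - G D F is a divergence plus Euler terms. *)
Lemma factorial_functional_lowering i j F G : F \is i.-homog -> G \is j.-homog ->
  Lam (F * lowering G) - Lam (G * lowering F) = (j%:R - i%:R) * Lam (F * G).
Proof.
move=> hF hG; rewrite mulrBl.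
have -> : j%:R * Lam (F * G) = Lam (F * (j%:R *: G)) by rewrite -scalerAr linearZ.
have -> : i%:R * Lam (F * G) = Lam (G * (i%:R *: F)).
  by rewrite [F * G]mulrC -scalerAr linearZ.
rewrite -(euler_homog hF) -(euler_homog hG) -!raddfB /= !(mulr_sumr, mulr_suml).
rewrite -!sumrB !raddf_sum; apply: eq_bigr => l _ /=.
rewrite (_ : F * _ - _ = \d_l ((F * \d_l G - G * \d_l F) * 'X_l)).
  by rewrite factorial_functional_deriv; congr (Lam _); ring.
by rewrite !(mderivM, mderivB) mderivX_id; ring.
Qed.

End FactorialFunctional.

(** * Orthogonality of harmonic forms and the coefficients of the projection *)

Section HarmonicProjection.
Context (n : nat) (R : numFieldType).
Implicit Types (F G V h : mpoly n.+1 R).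

Local Notation s := (varsum n.+1 R).
Local Notation Dn := (@lowering n.+1 R).
Local Notation Lam := (@factorial_functional n.+1 R).

(** With [D h = 0], integration by parts reads [Lam (h D G) = (j - i) Lam (h G)]. The scalar is
    nonzero and [D G] has smaller degree, whence an induction on [j] that starts from [D G = 0]. *)
Lemma harmonic_orthogonal i j h G : h \is i.-homog -> Dn h = 0 ->
  G \is j.-homog -> (j < i)%N -> Lam (h * G) = 0.
Proof.
move=> hh h0; elim: j G => [|j IH] G hG ji.
all: have /eqP := factorial_functional_lowering hh hG.
all: rewrite h0 mulr0 raddf0 subr0.
  rewrite lowering_homog0 // mulr0 raddf0 eq_sym mulf_eq0 subr_eq0 eqr_nat.
  by rewrite (ltn_eqF ji) => /eqP.
rewrite (IH _ (lowering_homog hG) (ltnW ji)) eq_sym mulf_eq0 subr_eq0 eqr_nat.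
by rewrite (ltn_eqF ji) => /eqP.
Qed.

(** The factors [s] come off one by one, each at the price of a scalar. *)
Lemma harmonic_orthogonal_varsumX k i j h G : h \is i.-homog -> Dn h = 0 ->
  G \is j.-homog -> (j < i)%N -> Lam (s ^+ k * h * G) = 0.
Proof.
move=> hh h0 hG ji; elim: k => [|k IH].
  by rewrite mul1r (harmonic_orthogonal hh h0 hG).
rewrite exprS -!mulrA (@factorial_functional_varsum _ _ (k + (i + j))).
  by rewrite mulrA IH mulr0.
exact/varsumXM_homog/(dhomogM hh).
Qed.

(** The scalar by which [D] takes [s^k h] to [s^(k-1) h], for [h] harmonic of degree [i] in [n.+1]
    variables. It is 0 at [k = 0], which makes the truncated exponent [k.-1] harmless. *)
Definition lowering_eigenvalue (i k : nat) : nat := k * (i.*2 + n + k).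

Lemma lowering_varsumXE k i h : h \is i.-homog -> Dn h = 0 ->
  Dn (s ^+ k * h) = (lowering_eigenvalue i k)%:R *: (s ^+ k.-1 * h).
Proof.
move=> hh h0; case: k => [|k]; first by rewrite !mul1r h0 scale0r.
by rewrite (lowering_varsumX k hh h0) /= /lowering_eigenvalue addnS addSnnS.
Qed.

Definition lowering_product (i k j : nat) : nat :=
  \prod_(l < j) lowering_eigenvalue i (k - l).

Lemma iter_lowering_varsumX j k i h : h \is i.-homog -> Dn h = 0 ->
  iter j Dn (s ^+ k * h) = (lowering_product i k j)%:R *: (s ^+ (k - j) * h).
Proof.
move=> hh h0; elim: j => [|j IH].
  by rewrite /lowering_product big_ord0 subn0 scale1r.
rewrite iterS IH linearZ /= (lowering_varsumXE _ hh h0) scalerA -natrM subnS.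
by rewrite /lowering_product big_ord_recr.
Qed.

(** For [k < j] the factor at [l = k] is 0; otherwise every [k - l] is positive. *)
Lemma lowering_product_eq0 i k j : (lowering_product i k j == 0%N) = (k < j)%N.
Proof.
apply/eqP/idP => [/eqP|kj]; last first.
  by rewrite /lowering_product (bigD1 (Ordinal kj)) //= subnn mul0n.
apply: contraLR; rewrite -leqNgt -!lt0n => jk; rewrite prodn_gt0 // => l.
by rewrite muln_gt0 addn_gt0 !subn_gt0 !(leq_trans (ltn_ord l)) ?orbT.
Qed.

Lemma iter_loweringD j F G : iter j Dn (F + G) = iter j Dn F + iter j Dn G.
Proof. by elim: j => //= j ->; rewrite raddfD. Qed.

Lemma iter_lowering0 j : iter j Dn 0 = 0.
Proof. by elim: j => //= j ->; rewrite raddf0. Qed.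

(** Each level lowers once on the way in and multiplies by [s] once on the way out, so no power of
    either operator is computed twice. *)
Fixpoint horner_lowering K (c : nat -> R) F : mpoly n.+1 R :=
  if K is K'.+1 then
    c 0%N *: F + s * horner_lowering K' (fun j => c j.+1) (Dn F)
  else c 0%N *: F.

Lemma horner_loweringE K c F : horner_lowering K c F =
  \sum_(j < K.+1) c j *: (s ^+ j * iter j Dn F).
Proof.
elim: K c F => [|K IH] c F /=; first by rewrite big_ord1 mul1r.
rewrite big_ord_recl mul1r IH mulr_sumr; congr (_ + _); apply: eq_bigr => j _.
by rewrite -scalerAr mulrA -exprS -iterSr.
Qed.

Lemma horner_lowering_homog K c F :
  F \is K.-homog -> horner_lowering K c F \is K.-homog.
Proof.
elim: K c F => [|K IH] c F hF /=; first exact: rpredZ.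
by apply: rpredD; [exact: rpredZ | exact/varsumM_homog/IH/lowering_homog].
Qed.

End HarmonicProjection.

Lemma triangular_system (R : fieldType) (a : nat -> nat -> R) (b : nat -> R) r :
  (forall t, (t < r)%N -> a t t != 0) ->
  exists c : nat -> R, forall t, (t < r)%N -> \sum_(j < t.+1) a t j * c j = b t.
Proof.
elim: r => [|r IH] art; first by exists (fun=> 0).
have [t tr|c hc] := IH; first exact/art/ltnW.
(* Forward substitution: row [r] determines the new value. All indices from [r] on receive it, but
   only index [r] is read. *)
exists (fun j => if (j < r)%N then c j
                 else (b r - \sum_(l < r) a r l * c l) / a r r) => t.
rewrite ltnS leq_eqVlt => /predU1P[->|tr].
  rewrite big_ord_recr /= ltnn mulrCA divff ?art // mulr1.
  under eq_bigr => l _ do rewrite ltn_ord.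
  by rewrite addrC subrK.
by rewrite -(hc t tr); apply: eq_bigr => l _; rewrite (leq_trans (ltn_ord l)).
Qed.

Section HarmonicProjectionCoefficients.
Context (n : nat) (R : numFieldType).

Local Notation s := (varsum n.+1 R).
Local Notation Dn := (@lowering n.+1 R).
Local Notation Lam := (@factorial_functional n.+1 R).

(* On the component s^k h of F, h harmonic of degree i = M + N - k, the remainder
   F - s^M (...) vanishes if i <= N by the choice of c, and is s^k h, orthogonal
   to all forms of degree N, if N < i. *)
Lemma projection_coefficients (M N : nat) : exists c : nat -> R,
  forall F V : mpoly n.+1 R, F \is (M + N).-homog -> V \is N.-homog ->
    Lam ((F - s ^+ M * horner_lowering N c (iter M Dn F)) * V) = 0.
Proof.
(* Row [t] stands for the components [s^(M+t) h] with [h] of degree [N - t]; the entry is the scalar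
   of [D^(j+M)] on them. It vanishes for [j > t], so the system is triangular, and the right-hand
   side 1 asks that the component be reproduced. *)
pose a t j : R := (lowering_product n (N - t) (M + t) (j + M))%:R.
have [t tN|c hc] := @triangular_system R a (fun=> 1) N.+1.
  by rewrite pnatr_eq0 lowering_product_eq0 addnC ltnn.
exists c => F V hF hV; move: F hF.
pose rem F := F - s ^+ M * horner_lowering N c (iter M Dn F).
have remD F G : rem (F + G) = rem F + rem G.
  rewrite /rem addrACA -opprD -mulrDr !horner_loweringE -big_split.
  congr (_ - _ * _); apply: eq_bigr => j _ /=.
  by rewrite !iter_loweringD mulrDr scalerDr.
apply: homog_harmonic_ind => [|F G hF hG|k i h kiK hh h0].
- rewrite horner_loweringE big1 ?mulr0 ?subr0 ?mul0r ?raddf0 // => j _.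
  by rewrite !iter_lowering0 mulr0 scaler0.
- by rewrite -/(rem _) remD mulrDl raddfD /= /rem hF hG addr0.
have [Ni|iN] := ltnP N i.
  rewrite horner_loweringE big1 ?mulr0 ?subr0; last first.
    move=> j _; rewrite -iterD (iter_lowering_varsumX _ _ hh h0).
    have /eqP-> : lowering_product n i k (j + M) == 0%N.
      by rewrite lowering_product_eq0; lia.
    by rewrite scale0r mulr0 scaler0.
  exact: (harmonic_orthogonal_varsumX _ hh h0 hV).
suff -> : s ^+ M * horner_lowering N c (iter M Dn (s ^+ k * h)) = s ^+ k * h.
  by rewrite subrr mul0r raddf0.
have [iE kE] : i = (N - (N - i))%N /\ k = (M + (N - i))%N by lia.
have tN : (N - i < N.+1)%N by rewrite ltnS leq_subr.
rewrite -[RHS]scale1r -(hc _ tN) horner_loweringE scaler_suml mulr_sumr.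
(* Both sums get the range [N.+1]; the terms with [j > N - i] vanish because [D^(j+M)] kills the
   component. *)
rewrite (big_ord_widen _ (fun j => (a (N - i)%N j * c j) *: (s ^+ k * h)) tN).
rewrite [RHS]big_mkcond; apply: eq_bigr => j _ /=.
rewrite -iterD (iter_lowering_varsumX _ _ hh h0) /a -iE -kE.
case: ltnP => jt; last first.
  have /eqP-> : lowering_product n i k (j + M) == 0%N.
    by rewrite lowering_product_eq0; lia.
  by rewrite scale0r mulr0 scaler0 mulr0.
rewrite -!scalerAr scalerA [c j * _]mulrC !mulrA -!exprD; congr (_ *: (s ^+ _ * h)).
lia.
Qed.

End HarmonicProjectionCoefficients.

(** * Integration over the simplex *)

(** The fundamental theorem of calculus, with the case [a = b] treated apart; it occurs below for a
    simplex shrunk to a point. *)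
Lemma integral_deriv_poly (R : realType) (Q : {poly R}) (a b : R) : a <= b ->
  (\int[@lebesgue_measure R]_(x in `[a, b]%classic) (Q^`().[x])%:E =
    (Q.[b] - Q.[a])%:E)%E.
Proof.
rewrite le_eqVlt => /predU1P[->|ab]; first by rewrite set_itv1 integral_set1 subrr.
rewrite (@continuous_FTC2 _ _ (horner Q)) //.
- exact/continuous_subspaceT/continuous_horner.
- split; first by move=> x _; exact: derivable_horner.
  + exact/cvg_at_right_filter/continuous_horner.
  + exact/cvg_at_left_filter/continuous_horner.
- by move=> x _; rewrite derivE.
Qed.

(** * The Beta integral by polynomial primitives *)

Section BetaPrimitive.
Context (R : realType) (t : R).

Local Notation y := (2^-1 *: (1 + 'X) : {poly R}).
Local Notation z := (t%:P - y).

(** On [[-1, 2 t - 1]] the affine function [y] runs from 0 to [t], and the factor 2 comes from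
    [dx = 2 dy]. Induction on [a] integrates by parts, trading a factor [y] for a factor [z]. *)
Lemma beta_primitive a b : exists Q : {poly R}, Q^`() = y ^+ a * z ^+ b /\
  Q.[2 * t - 1] - Q.[-1] =
    2 * (a`! * b`!)%:R / (a + b).+1`!%:R * t ^+ (a + b).+1.
Proof.
have dy : y^`() = (2^-1)%:P.
  by rewrite derivZ derivD derivX -alg_polyC; congr (_ *: _); rewrite derivC add0r.
have dz : z^`() = - (2^-1)%:P by rewrite derivB derivC sub0r dy.
have y0 : y.[-1] = 0 by rewrite !hornerE subrr mulr0.
have y1 : y.[2 * t - 1] = t.
  by rewrite hornerZ hornerD hornerX -polyC1 hornerC; field.
have z0 : z.[-1] = t by rewrite hornerD hornerN y0 hornerC subr0.
have z1 : z.[2 * t - 1] = 0 by rewrite hornerD hornerN y1 hornerC subrr.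
elim: a b => [|a IH] b.
  have b0 : b.+1%:R != 0 :> R by rewrite pnatr_eq0.
  exists ((- 2 / b.+1%:R) *: z ^+ b.+1); split.
    rewrite derivZ deriv_exp dz -polyCN mul_polyC scalerMnl scalerA mul1r -mulr_natr.
    by rewrite -[RHS]scale1r; congr (_ *: _); field.
  rewrite !hornerZ !horner_exp z0 z1 expr0n /= mulr0 sub0r add0n mul1n.
  rewrite factS natrM; field.
  by rewrite nat1r !pnatr_eq0 -lt0n fact_gt0.
have [Q [dQ Q01]] := IH b.+1.
have b0 : b.+1%:R != 0 :> R by rewrite pnatr_eq0.
(* The product rule for [y^(a+1) z^(b+1)], solved for [y^(a+1) z^b]. This product vanishes at both
   endpoints, so only [Q] contributes to the increment. *)
exists (b.+1%:R^-1 *: (a.+1%:R *: Q - 2 *: (y ^+ a.+1 * z ^+ b.+1))); split.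
  rewrite derivZ derivB !derivZ dQ derivM !deriv_exp dz dy.
  apply: (scalerI b0); rewrite scalerA divff // scale1r.
  have : 2 *: (2^-1)%:P = 1 :> {poly R}.
    by rewrite scale_polyC divff ?pnatr_eq0 ?polyC1.
  rewrite !scaler_nat /=; move: (y) (z) (2^-1)%:P => Y Z H H1.
  set U := Y ^+ a * Z ^+ b.+1; set V := Y ^+ a.+1 * Z ^+ b.
  (* [H] stands for the constant 1/2: the error is displayed as a multiple of [1 - 2 H], which
     leaves an identity for [ring]. *)
  rewrite (_ : _ - _ = (1 - H *+ 2) * (U *+ a.+1 - V *+ b.+1) + V *+ b.+1).
    by rewrite H1 subrr mul0r add0r.
  by rewrite /U /V; ring.
have hornerQ (c1 c2 c3 x : R) (A B : {poly R}) :
    (c1 *: (c2 *: Q - c3 *: (A * B))).[x] =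
    c1 * (c2 * Q.[x] - c3 * (A.[x] * B.[x])).
  by rewrite hornerZ hornerD hornerN !hornerZ hornerM.
rewrite !hornerQ !horner_exp y0 y1 z0 z1 !expr0n /= mul0r mulr0 mulr0 !subr0 -mulrBr.
rewrite -mulrBr Q01 addSnnS.
apply: (mulfI b0); rewrite mulVKf // !factS !natrM.
ring.
Qed.

End BetaPrimitive.

(** * Dirichlet's formula on scaled simplices *)

Section Dirichlet.
Context (R : realType).
Local Notation T := (measurableTypeR R).
Local Open Scope classical_set_scope.

Definition bary_coord (x : R) : R := (1 + x) / 2.

(** The bound [t] is a parameter because fixing the first coordinate leaves a simplex of the same
    kind with a smaller bound; the reference simplex is the case [t = 1]. *)
Definition scaled_simplex n (t : R) : set (n.-tuple T) :=
  [set x | (forall i, -1 <= tnth x i) /\ \sum_i bary_coord (tnth x i) <= t].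

Definition dirichlet_density n (t : R) (a : 'I_n -> nat) (b : nat)
    (x : n.-tuple T) : R :=
  \prod_i bary_coord (tnth x i) ^+ a i *
    (t - \sum_i bary_coord (tnth x i)) ^+ b.

Lemma measurable_bary_coord_tnth n (i : 'I_n) :
  measurable_fun [set: n.-tuple T] (fun x => bary_coord (tnth x i)).
Proof.
apply: measurable_funM => //; apply: measurable_funD => //.
exact: measurable_tnth.
Qed.

Lemma measurable_sum_bary_coord n :
  measurable_fun [set: n.-tuple T] (fun x => \sum_i bary_coord (tnth x i)).
Proof. by apply: measurable_sum => i; exact: measurable_bary_coord_tnth. Qed.

Lemma measurable_dirichlet_density n t (a : 'I_n -> nat) b :
  measurable_fun [set: n.-tuple T] (dirichlet_density t a b).
Proof.
apply: measurable_funM.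
  apply: measurable_prod => i _; apply: measurable_funX.
  exact: measurable_bary_coord_tnth.
apply: measurable_funX; apply: measurable_funB => //.
exact: measurable_sum_bary_coord.
Qed.

Lemma measurable_scaled_simplex n t : measurable (@scaled_simplex n t).
Proof.
rewrite [X in measurable X](_ : _ =
    (\bigcap_(i in [set: 'I_n]) ((@tnth _ T ^~ i) @^-1` `[-1, +oo[)) `&`
    ((fun x => \sum_i bary_coord (tnth x i)) @^-1` `]-oo, t])); last first.
  apply/seteqP; split => x /= [x1 xt].
    by split=> [i _|]; rewrite /= in_itv /= ?andbT.
  split; last by move: xt; rewrite in_itv.
  by move=> i; move: (x1 i I); rewrite /= in_itv /= andbT.
apply: measurableI.
  apply: fin_bigcap_measurable; first exact: finite_finset.
  move=> i _; rewrite -[X in measurable X]setTI.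
  by apply: measurable_tnth => //; exact: measurable_itv.
rewrite -[X in measurable X]setTI.
by apply: measurable_sum_bary_coord => //; exact: measurable_itv.
Qed.

Lemma bary_coord_ge0 x : -1 <= x -> 0 <= bary_coord x.
Proof. by rewrite /bary_coord; lra. Qed.

Lemma dirichlet_density_ge0 n t (a : 'I_n -> nat) b x :
  scaled_simplex t x -> 0 <= dirichlet_density t a b x.
Proof.
move=> [x1 xt]; rewrite mulr_ge0 //; last by rewrite exprn_ge0 // subr_ge0.
by apply: prodr_ge0 => i _; rewrite exprn_ge0 // bary_coord_ge0.
Qed.

Lemma scaled_simplex_cons n t (p : T * n.-tuple T) :
  scaled_simplex t (cons_pair p) <->
  -1 <= p.1 /\ scaled_simplex (t - bary_coord p.1) p.2.
Proof.
have tnthS (i : 'I_n) : tnth (cons_pair p) (lift ord0 i) = tnth p.2 i.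
  by rewrite tnthS.
rewrite /scaled_simplex /= big_ord_recl /= lerBrDl.
under eq_bigr => i _ do rewrite tnthS.
rewrite tnth0; split => [[x1 xt]|[x1 [y1 xt]]].
  split; first exact: (x1 ord0).
  by split => // i; rewrite -tnthS.
split => // i; case: (unliftP ord0 i) => [j|] ->; first by rewrite tnthS.
by rewrite tnth0.
Qed.

Lemma dirichlet_density_cons n t a b (p : T * n.-tuple T) :
  dirichlet_density t a b (cons_pair p) =
  bary_coord p.1 ^+ a ord0 *
    dirichlet_density (t - bary_coord p.1) (fun i => a (lift ord0 i)) b p.2.
Proof.
rewrite /dirichlet_density !big_ord_recl tnth0 mulrA opprD addrA.
by congr (_ * _ * (_ - _) ^+ _); apply: eq_bigr => i _; rewrite tnthS.
Qed.

Lemma scaled_simplex_neg n t : t < 0 -> @scaled_simplex n t = set0.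
Proof.
move=> t0; apply/seteqP; split => // x [x1 xt].
have : 0 <= \sum_i bary_coord (tnth x i).
  by apply: sumr_ge0 => i _; exact: bary_coord_ge0.
by move=> /le_trans /(_ xt); rewrite leNgt t0.
Qed.

Local Open Scope ereal_scope.

(** Tonelli's theorem splits off the first coordinate. By induction the integral over a slice is
    [C (t - y)^B], and the remaining integral is a Beta integral. For [n = 0] the measure is a point
    mass and the value is [t^b]. *)
Lemma dirichlet_integral n t (a : 'I_n -> nat) b : (0 <= t)%R ->
  \int[lebesgue_tuple R n]_(x in scaled_simplex t) (dirichlet_density t a b x)%:E =
  (2 ^+ n * (\prod_i (a i)`! * b`!)%:R / (\sum_i a i + b + n)`!%:R *
     t ^+ (\sum_i a i + b + n))%:E.
Proof.
elim: n t a => [|n IH] t a t0.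
  rewrite integral_dirac //; last 2 first.
  - exact: measurable_scaled_simplex.
  - apply/measurable_EFinP/measurable_funTS; exact: measurable_dirichlet_density.
  rewrite diracE mem_set; last by split=> [[]//|] ; rewrite big_ord0.
  rewrite mul1e /dirichlet_density !big_ord0 subr0 mul1r expr0 addn0 add0n.
  by rewrite mul1r mul1n divff ?mul1r // pnatr_eq0 -lt0n fact_gt0.
(* Extension by zero, so that the integral is over the whole product space. *)
rewrite integral_mkcond /=.
set f := (X in integral _ _ X).
have mf : measurable_fun setT f.
  apply/(measurable_restrictT _ _).1; first exact: measurable_scaled_simplex.
  by apply/measurable_EFinP/measurable_funTS; exact: measurable_dirichlet_density.
have f0 x : 0 <= f x.
  rewrite /f patchE; case: ifPn => // /set_mem xS.
  by rewrite lee_fin; exact: dirichlet_density_ge0.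
rewrite (ge0_integral_pushforward (@measurable_cons_pair R n)) //=.
rewrite (@fubini_tonelli1 _ _ _ _ _ lebesgue_measure (lebesgue_tuple R n)
  (f \o @cons_pair R n)) /=; last 2 first.
- by apply: measurableT_comp => //; exact: measurable_cons_pair.
- by move=> x /=.
pose B := (\sum_(i < n) a (lift ord0 i) + b + n)%N.
pose C : R := (2 ^+ n * (\prod_(i < n) (a (lift ord0 i))`! * b`!)%:R / B`!%:R)%R.
pose y : {poly R} := (2^-1 *: (1 + 'X))%R.
have yE x : y.[x]%R = bary_coord x by rewrite hornerZ hornerD hornerX -polyC1 hornerC mulrC.
have [Q [dQ Q01]] := beta_primitive t (a ord0) B.
transitivity (\int[@lebesgue_measure R]_(x in `[(-1)%R, (2 * t - 1)%R])
    ((C *: Q)^`().[x])%:E).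
  rewrite [RHS]integral_mkcond; apply: eq_integral => x _.
  rewrite /fubini_F patchE /=.
  have fE z : f (cons_pair (x, z)) = if (-1 <= x)%R then
    ((bary_coord x ^+ a ord0)%:E * ((EFin \o dirichlet_density (t - bary_coord x)
      (fun i => a (lift ord0 i)) b) \_ (scaled_simplex (t - bary_coord x))) z)
    else 0.
    rewrite /f !patchE; case: ifPn => [/set_mem/scaled_simplex_cons[/= x1 zS]|].
      by rewrite x1 mem_set //= dirichlet_density_cons EFinM.
    move=> /negP zS; case: ifPn => // x1; rewrite ifF ?mule0 //.
    apply/negP => /set_mem zS'; apply: zS; apply/mem_set/scaled_simplex_cons.
    by split.
  under eq_integral => z _ do rewrite fE.
  have [x1|x1] := leP (-1)%R x; last first.
    by rewrite integral0 ifF //; apply/negP => /set_mem /=; rewrite in_itv /= leNgt x1.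
  rewrite ge0_integralZl_EFin //; last 3 first.
  - by move=> z _; rewrite patchE; case: ifPn => // /set_mem zS;
      rewrite lee_fin; exact: dirichlet_density_ge0.
  - apply/(measurable_restrictT _ _).1; first exact: measurable_scaled_simplex.
    by apply/measurable_EFinP/measurable_funTS; exact: measurable_dirichlet_density.
  - by rewrite exprn_ge0 // bary_coord_ge0.
  rewrite -integral_mkcond; case: ifPn => [/set_mem|/negP xt].
    rewrite /= in_itv /= => /andP[_ xt].
    rewrite IH; last by rewrite subr_ge0 /bary_coord; lra.
    rewrite derivZ dQ hornerZ hornerM !horner_exp hornerD hornerN hornerC -/y yE.
    by rewrite -EFinM -/B -/C mulrCA.
  (* Beyond [2 t - 1] the bound of the slice is negative and the slice is empty. *)
  rewrite scaled_simplex_neg ?integral_set0 ?mule0 // subr_lt0 ltNge.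
  apply/negP => xt'; apply: xt; apply/mem_set => /=; rewrite in_itv /= x1 /=.
  by move: xt'; rewrite /bary_coord; lra.
rewrite integral_deriv_poly; last lra.
rewrite !hornerZ -mulrBr Q01 !big_ord_recl.
have -> : (a ord0 + \sum_(i < n) a (lift ord0 i) + b + n.+1 = (a ord0 + B).+1)%N.
  by rewrite /B addnS !addnA.
have fact_neq0 k : k`!%:R != 0%R :> R by rewrite pnatr_eq0 -lt0n fact_gt0.
have := fact_neq0 (a ord0 + B).+1; have := fact_neq0 B; rewrite /C.
move: (_.+1`!%:R)%R (t ^+ _)%R (B`!) => F tB FB FB0 F0.
by rewrite exprS !natrM; congr EFin; field; rewrite ?FB0 ?F0.
Qed.

End Dirichlet.

(** * Forms as polynomials on the simplex *)

Section Dehomogenization.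
Context (R : realType) (d : nat).
Local Notation T := (measurableTypeR R).
Implicit Types (F G V : mpoly d.+1 R) (p v : mpoly d R).

Definition dehomogenize F : mpoly d R :=
  comp_mpoly [tuple barycentric R i | i < d.+1] F.

HB.instance Definition _ := GRing.LRMorphism.copy dehomogenize dehomogenize.

Lemma dehomogenizeX (m : multinom d.+1) :
  dehomogenize (mpolyX R m) = \prod_i barycentric R i ^+ m i.
Proof.
by rewrite [LHS]comp_mpolyX; apply: eq_bigr => i _; rewrite tnth_mktuple.
Qed.

Lemma dehomogenizeXU i : dehomogenize (mpolyX R (mnm1 i)) = barycentric R i.
Proof. by rewrite [LHS]comp_mpolyXU (nth_mktuple _ _ i). Qed.

Lemma dehomogenize_varsum : dehomogenize (varsum d.+1 R) = 1.
Proof.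
rewrite raddf_sum big_ord_recl /= dehomogenizeXU {1}/barycentric unlift_none.
under eq_bigr => i _ do rewrite dehomogenizeXU /barycentric liftK.
by rewrite subrK.
Qed.

Lemma meval_barycentric (x : d.-tuple R) i :
  meval (tnth x) (barycentric R i) =
  if unlift ord0 i is Some j then bary_coord (tnth x j)
  else 1 - \sum_j bary_coord (tnth x j).
Proof.
have mevalE (j : 'I_d) : meval (tnth x) ((2^-1 : R) *: (1 + mpolyX R (mnm1 j))) =
    bary_coord (tnth x j).
  by rewrite mevalZ mevalD meval1 mevalXU mulrC.
rewrite /barycentric; case: unliftP => [j _|_]; first exact: mevalE.
rewrite mevalB meval1; congr (_ - _); rewrite raddf_sum; apply: eq_bigr => j _.
exact: mevalE.
Qed.

Lemma meval_dehomogenizeX (x : d.-tuple R) (m : multinom d.+1) :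
  meval (tnth x) (dehomogenize (mpolyX R m)) =
  dirichlet_density 1 (fun i => m (lift ord0 i)) (m ord0) x.
Proof.
rewrite dehomogenizeX rmorph_prod /= big_ord_recl rmorphXn /=.
rewrite meval_barycentric unlift_none mulrC; congr (_ * _).
by apply: eq_bigr => i _; rewrite rmorphXn /= meval_barycentric liftK.
Qed.

Lemma simplexE : simplex (R := R) (d := d) = scaled_simplex 1.
Proof.
apply/seteqP; split => x [x1 xd]; split => //; move: xd.
all: rewrite -mulr_suml big_split sumr_const card_ord /=.
all: set S := \sum_i _; move: S => S; lra.
Qed.

Local Open Scope ereal_scope.

(** Dirichlet's formula, monomial by monomial; its denominator depends only on the degree, which all
    monomials of [F] share. Integrability is carried along because additivity of the integral
    requires it. *)
Lemma integral_dehomogenize K F : F \is K.-homog ->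
  (lebesgue_tuple R d).-integrable (simplex (R := R) (d := d))
    (fun x => (meval (tnth x) (dehomogenize F))%:E) /\
  \int[lebesgue_tuple R d]_(x in simplex (R := R) (d := d))
    (meval (tnth x) (dehomogenize F))%:E =
  (2 ^+ d / (K + d)`!%:R * factorial_functional F)%:E.
Proof.
have mS : measurable (simplex (R := R) (d := d) : set (d.-tuple T)).
  by rewrite simplexE; exact: measurable_scaled_simplex.
pose P F := (lebesgue_tuple R d).-integrable (simplex (R := R) (d := d))
    (fun x => (meval (tnth x) (dehomogenize F))%:E) /\
  \int[lebesgue_tuple R d]_(x in simplex (R := R) (d := d))
    (meval (tnth x) (dehomogenize F))%:E =
  (2 ^+ d / (K + d)`!%:R * factorial_functional F)%:E.
move=> hF; rewrite -/(P F) [F]mpolyE big_seq; apply: (big_ind P).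
- rewrite /P; under eq_fun do rewrite !raddf0.
  split; first exact: integrable0.
  by rewrite integral0_eq ?raddf0 ?mulr0 // => x _; rewrite !raddf0.
- move=> {hF}F G [iF FE] [iG GE]; rewrite /P.
  under eq_fun do rewrite !raddfD /=.
  split; first exact: integrableD.
  by rewrite integralD_EFin // FE GE raddfD /= mulrDr EFinD.
move=> m /(dhomog_mf hF) /= mK; rewrite /P.
under eq_fun do rewrite !linearZ /= EFinM.
set c : R := mcoeff m F.
set f := fun x : d.-tuple T => (meval (tnth x) (dehomogenize (mpolyX R m)))%:E.
have fE : f = EFin \o dirichlet_density 1 (fun i => m (lift ord0 i)) (m ord0).
  by apply/funext => x; rewrite /f meval_dehomogenizeX.
have fint : \int[lebesgue_tuple R d]_(x in simplex (R := R) (d := d)) f x =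
    (2 ^+ d / (K + d)`!%:R * (mfact m)%:R)%:E.
  rewrite fE simplexE dirichlet_integral // expr1n mulr1 -mK mdegE.
  rewrite /mfact !big_ord_recl [(_ + m ord0)%N]addnC [in RHS]mulnC.
  by rewrite mulrAC.
have if_ : (lebesgue_tuple R d).-integrable (simplex (R := R) (d := d)) f.
  apply/integrableP; split.
    rewrite fE; apply/measurable_EFinP/measurable_funTS.
    exact: measurable_dirichlet_density.
  rewrite (eq_integral f) ?fint ?ltry // => x /set_mem; rewrite simplexE => xS.
  by rewrite gee0_abs // fE lee_fin; exact: dirichlet_density_ge0.
split; first exact: integrableZl.
rewrite integralZl // fint linearZ /= factorial_functionalX -EFinM.
by rewrite mulrCA.
Qed.

Local Close Scope ereal_scope.

Lemma msizeP p k : reflect (forall m, m \in msupp p -> (mdeg m < k)%N) (msize p <= k)%N.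
Proof.
by rewrite msizeE; apply: (iffP (bigmax_leqP_seq _ _ _ _)) => h m; move/h; exact.
Qed.

Lemma polysD N p v : polys N p -> polys N v -> polys N (p + v).
Proof.
move=> pN vN; rewrite /polys /= (leq_trans (msizeD_le _ _)) //.
by rewrite geq_max; apply/andP.
Qed.

Lemma polysM N K p v : polys N p -> polys K v -> polys (N + K) (p * v).
Proof.
move=> /msizeP pN /msizeP vK; apply/msizeP => m /msuppM_le/allpairsP[[m1 m2] /=].
by move=> [/pN m1N /vK m2K ->]; rewrite mdegD ltnS leq_add.
Qed.

Lemma polys_exp N p k : polys N p -> polys (k * N) (p ^+ k).
Proof.
move=> pN; elim: k => [|k IH]; first by rewrite /polys /= expr0 msize1.
by rewrite exprS mulSn; exact: polysM.
Qed.

Lemma polysZ N c p : polys N p -> polys N (c *: p).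
Proof. by move=> pN; rewrite /polys /= (leq_trans (msizeZ_le _ _)). Qed.

Lemma polys_barycentric i : polys 1 (barycentric R (d := d) i).
Proof.
have p1 : polys 1 (1 : mpoly d R) by rewrite /polys /= msize1.
have pX (j : 'I_d) : polys 1 ((2^-1 : R) *: (1 + mpolyX R (mnm1 j))).
  by apply/polysZ/polysD => //; rewrite /polys /= msizeX mdeg1.
rewrite /barycentric; case: unlift => [j|]; first exact: pX.
apply: polysD => //; rewrite -scaleN1r; apply: polysZ.
apply: (big_ind (polys 1)) => //; first by rewrite /polys /= msize0.
by move=> p v; exact: polysD.
Qed.

Lemma polys_dehomogenize K F : F \is K.-homog -> polys K (dehomogenize F).
Proof.
move=> hF; rewrite [F]mpolyE raddf_sum big_seq /=.
apply: (big_ind (polys K)); first by rewrite /polys /= msize0.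
  by move=> p v; exact: polysD.
move=> m /(dhomog_mf hF) /= <-; rewrite linearZ /=; apply: polysZ.
rewrite dehomogenizeX mdegE; apply: (big_ind2 (fun p k => polys k p)).
- by rewrite /polys /= msize1.
- by move=> p k v l; exact: polysM.
- by move=> i _; have := polys_exp (m i) (polys_barycentric i); rewrite muln1.
Qed.

(** Since [x_j = 2 lambda_j - 1], the variable [x_j] lifts to the linear form [2 X_j - s], and
    powers of [s] pad every monomial to degree exactly [N]. *)
Lemma polys_homogenize N v : polys N v ->
  exists2 V, V \is N.-homog & dehomogenize V = v.
Proof.
move=> /msizeP vN; rewrite [v]mpolyE big_seq.
apply: (big_ind (fun v => exists2 V, V \is N.-homog & dehomogenize V = v)).
- by exists 0; rewrite ?raddf0 ?rpred0.
- move=> _ _ [V hV <-] [W hW <-]; exists (V + W); first exact: rpredD.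
  by rewrite raddfD.
move=> m /vN; rewrite ltnS => mN; set s := varsum d.+1 R.
pose x (j : 'I_d) : mpoly d.+1 R := 2 *: mpolyX R (mnm1 (lift ord0 j)) - s.
have hx j : x j \is 1.-homog.
  by rewrite rpredB ?varsum_homog // rpredZ // dhomogX /= mdeg1.
exists (mcoeff m v *: (s ^+ (N - mdeg m) * \prod_j x j ^+ m j)).
  suff hX : \prod_j x j ^+ m j \is (mdeg m).-homog.
    by apply: rpredZ; rewrite -{2}(subnK mN); exact: varsumXM_homog.
  rewrite mdegE.
  elim/big_rec2: _ => [|j k q _ hq]; first exact: dhomog1.
  by apply: dhomogM => //; have := dhomogMn (m j) (hx j); rewrite mul1n.
rewrite linearZ rmorphM rmorphXn /= dehomogenize_varsum expr1n mul1r mpolyXE_id.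
rewrite rmorph_prod; congr (_ *: _); apply: eq_bigr => j _ /=.
rewrite rmorphXn /= raddfB /= linearZ /= dehomogenizeXU dehomogenize_varsum.
by rewrite /barycentric liftK scalerA divff ?pnatr_eq0 // scale1r addrC addKr.
Qed.

Lemma is_L2_projection_dehomogenize M N F Q :
  F \is (M + N).-homog -> Q \is N.-homog ->
  (forall V, V \is N.-homog ->
     factorial_functional ((F - varsum d.+1 R ^+ M * Q) * V) = 0) ->
  is_L2_projection N (dehomogenize F) (dehomogenize Q).
Proof.
move=> hF hQ FQ; split; first exact: polys_dehomogenize.
move=> v /polys_homogenize[V hV <-].
(* The image 1 of [s^M] is inserted before [Q], so that the difference comes from a single form of
   degree [M + N]. *)
rewrite /L2_inner; under eq_integral => x _.
  rewrite -mevalM -[dehomogenize Q]mul1r -(expr1n _ M) -dehomogenize_varsum.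
  rewrite -rmorphXn -rmorphM -raddfB -rmorphM /=.
  over.
have hFQV : (F - varsum d.+1 R ^+ M * Q) * V \is (M + N + N).-homog.
  by apply: dhomogM => //; apply: rpredB => //; exact: varsumXM_homog.
by rewrite (integral_dehomogenize hFQV).2 FQ // mulr0.
Qed.

End Dehomogenization.

(** * Straight-line programs *)

Section Computable.
Context (R : nzRingType).

Section Run.
Context (I : Type).
Implicit Types (x : I -> R) (vals : seq R) (gs : seq (gate R I)).

(** The initial results are a parameter so that programs can be concatenated. *)
Definition slp_run x gs vals :=
  foldl (fun vals g => rcons vals (gate_val x vals g)) vals gs.

Lemma slp_run_cat x gs gs' vals :
  slp_run x (gs ++ gs') vals = slp_run x gs' (slp_run x gs vals).
Proof. exact: foldl_cat. Qed.

Lemma size_slp_run x gs vals : size (slp_run x gs vals) = (size vals + size gs)%N.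
Proof.
elim: gs vals => [|g gs IH] vals; first by rewrite addn0.
by rewrite /= IH size_rcons addSnnS.
Qed.

(* Results that do not exist yet, hence read [0], must not be captured by the gates
   of a program appended later. *)
Definition restrict_operand n (o : operand R I) : operand R I :=
  if o is Result k then if (k < n)%N then o else Const I 0 else o.

Lemma restrict_operandE x vals vals' o :
  operand_val x (vals ++ vals') (restrict_operand (size vals) o) =
  operand_val x vals o.
Proof.
case: o => //= k; case: ltnP => kn /=; first by rewrite nth_cat kn.
by rewrite nth_default.
Qed.

End Run.

Section Substitution.
Context (I J : Type) (n : nat) (sigma : J -> operand R I).

Definition subst_operand (o : operand R J) : operand R I :=
  match o with
  | Const c => Const I c
  | Input j => restrict_operand n (sigma j)
  | Result k => Result R I (n + k)
  end.

Definition subst_gate (g : gate R J) : gate R I :=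
  match g with
  | Add a b => Add (subst_operand a) (subst_operand b)
  | Mul a b => Mul (subst_operand a) (subst_operand b)
  end.

Lemma subst_operandE (x : I -> R) vals vals' o : size vals = n ->
  operand_val x (vals ++ vals') (subst_operand o) =
  operand_val (operand_val x vals \o sigma) vals' o.
Proof.
move=> sz; case: o => [//|j|k] /=; rewrite -sz; first exact: restrict_operandE.
by rewrite nth_cat ltnNge leq_addr addKn.
Qed.

(** The earlier results remain a prefix throughout, so each relocated gate reads what the original
    gate would read. *)
Lemma slp_run_subst (x : I -> R) vals vals' gs : size vals = n ->
  slp_run x [seq subst_gate g | g <- gs] (vals ++ vals') =
  vals ++ slp_run (operand_val x vals \o sigma) gs vals'.
Proof.
move=> sz; elim: gs vals' => //= g gs IH vals'.
rewrite -IH -rcons_cat; congr (slp_run _ _ (rcons _ _)).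
by case: g => a b /=; rewrite !subst_operandE.
Qed.

End Substitution.

(** Only gates are counted, so [I] and [O] may be infinite; below they are often the type of all
    multinomials. *)
Definition computable I O k (f : (I -> R) -> O -> R) :=
  exists P : slp R I O, (slp_cost P <= k)%N /\
    forall x o, slp_eval P x o = f x o.

(** * Rules for combining programs and their costs *)

Section Combinators.
Context (I : Type).

Lemma computable_leq O k l (f g : (I -> R) -> O -> R) :
  computable k f -> (k <= l)%N -> (forall x o, f x o = g x o) -> computable l g.
Proof.
by move=> [P [Pk Pf]] kl fg; exists P; split=> [|x o]; rewrite ?Pf ?(leq_trans Pk).
Qed.

Lemma computable_operand O (h : O -> I + R) :
  computable 0 (fun x o => match h o with inl i => x i | inr c => c end).
Proof.
exists (Slp [::] (fun o => match h o with inl i => Input R i | inr c => Const I c end)).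
by split=> // x o; rewrite /slp_eval /=; case: (h o).
Qed.

(** The gates of the second program follow those of the first, with inputs wired to its outputs.
    Extensionality of [g] bridges the pointwise agreement of the first program with [f]. *)
Lemma computable_comp J O k l (f : (I -> R) -> J -> R) (g : (J -> R) -> O -> R) :
  (forall y z, y =1 z -> g y =1 g z) ->
  computable k f -> computable l g -> computable (k + l) (fun x => g (f x)).
Proof.
move=> g_ext [P [Pk Pf]] [Q [Ql Qg]]; pose n := size (gates P).
exists (Slp (gates P ++ [seq subst_gate n (output P) g | g <- gates Q])
            (fun o => subst_operand n (output P) (output Q o))).
split=> [|x o]; first by rewrite /slp_cost size_cat size_map leq_add.
rewrite /slp_eval -!/(slp_run _ _ _) /= slp_run_cat.
have sz : size (slp_run x (gates P) [::]) = n by rewrite size_slp_run.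
rewrite -[slp_run x (gates P) _]cats0 slp_run_subst // subst_operandE //.
by rewrite -/(slp_eval Q _ o) Qg; apply: g_ext => j; exact: Pf.
Qed.

Lemma computable_reindex J O k (f : (I -> R) -> J -> R) (h : O -> J + R) :
  computable k f ->
  computable k (fun x o => match h o with inl j => f x j | inr c => c end).
Proof.
move=> [P [Pk Pf]]; exists (Slp (gates P) (fun o =>
  match h o with inl j => output P j | inr c => Const I c end)).
by split=> // x o; rewrite /slp_eval /=; case: (h o) => // j; rewrite -Pf.
Qed.

Lemma computable_pair J O k l (f : (I -> R) -> J -> R) (g : (I -> R) -> O -> R) :
  computable k f -> computable l g ->
  computable (k + l) (fun x => sum_input (f x) (g x)).
Proof.
move=> [P [Pk Pf]] [Q [Ql Qg]]; pose n := size (gates P); pose sg := @Input R I.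
exists (Slp (gates P ++ [seq subst_gate n sg g | g <- gates Q])
            (fun o => match o with
                      | inl j => restrict_operand n (output P j)
                      | inr o => subst_operand n sg (output Q o)
                      end)).
split=> [|x o]; first by rewrite /slp_cost size_cat size_map leq_add.
rewrite /slp_eval -!/(slp_run _ _ _) /= slp_run_cat.
have sz : size (slp_run x (gates P) [::]) = n by rewrite size_slp_run.
rewrite -[slp_run x (gates P) _]cats0 slp_run_subst //.
case: o => [j|o] /=; first by rewrite -sz restrict_operandE; exact: Pf.
by rewrite subst_operandE //; exact: Qg.
Qed.

Definition computable1 k (a : (I -> R) -> R) := computable k (fun x (_ : unit) => a x).

Lemma computable1_const c : computable1 0 (fun=> c).
Proof. exact: (computable_operand (fun=> inr c)). Qed.

Lemma computable1_input i : computable1 0 (fun x => x i).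
Proof. exact: (computable_operand (fun=> inl i)). Qed.

Lemma computable1_gate (op : R -> R -> R)
    (G : forall J : Type, operand R J -> operand R J -> gate R J) :
  (forall J (y : J -> R) vals o o',
     gate_val y vals (G J o o') = op (operand_val y vals o) (operand_val y vals o')) ->
  forall k l a b, computable1 k a -> computable1 l b ->
  computable1 (k + l).+1 (fun x => op (a x) (b x)).
Proof.
move=> GE k l a b ha hb; rewrite -addn1.
pose g (y : unit + unit -> R) (_ : unit) := op (y (inl tt)) (y (inr tt)).
apply: (computable_comp (g := g) _ (computable_pair ha hb)).
  by move=> y z yz o; rewrite /g !yz.
exists (Slp [:: G _ (Input R (inl tt)) (Input R (inr tt))] (fun=> Result R _ 0)).
by split=> // y o; rewrite /slp_eval /= GE.
Qed.

Lemma computable1D k l a b : computable1 k a -> computable1 l b ->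
  computable1 (k + l).+1 (fun x => a x + b x).
Proof. exact: (computable1_gate (G := fun J => @Add R J)). Qed.

Lemma computable1M k l a b : computable1 k a -> computable1 l b ->
  computable1 (k + l).+1 (fun x => a x * b x).
Proof. exact: (computable1_gate (G := fun J => @Mul R J)). Qed.

Lemma computable1_sum (T : Type) (s : seq T) k (a : T -> (I -> R) -> R) :
  (forall t, computable1 k (a t)) ->
  computable1 (size s * k.+1) (fun x => \sum_(t <- s) a t x).
Proof.
move=> ha; elim: s => [|t s IH].
  by apply: computable_leq (computable1_const 0) _ _ => // x _; rewrite big_nil.
apply: computable_leq (computable1D (ha t) IH) _ _ => [|x _].
  by rewrite mulSn addSn.
by rewrite big_cons.
Qed.

(** Outputs outside [s] are the constant 0, hence free; the others are computed by separate programs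
    of cost [k]. *)
Lemma computable_seq (O : eqType) (s : seq O) k (f : (I -> R) -> O -> R) :
  (forall o, o \in s -> computable1 k (fun x => f x o)) ->
  (forall x o, o \notin s -> f x o = 0) -> computable (size s * k) f.
Proof.
move=> fk f0; suff: computable (size s * k) (fun x o => if o \in s then f x o else 0).
  move=> h; apply: computable_leq h _ _ => // x o.
  by case: ifPn => // /f0->.
elim: s fk {f0} => [|o0 s IH] fk.
  by apply: computable_leq (computable_operand (fun=> inr 0)) _ _.
have h0 := fk o0 (mem_head _ _).
have hs : computable (size s * k) (fun x o => if o \in s then f x o else 0).
  by apply: IH => o os; apply: fk; rewrite inE os orbT.
apply: computable_leq (computable_reindex
  (fun o => inl (if o == o0 then inl tt else inr o)) (computable_pair h0 hs)) _ _.
  by rewrite mulSn.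
by move=> x o; rewrite in_cons; case: eqP => [->|].
Qed.

End Combinators.
End Computable.
Arguments computable1_const {R I} c.
Arguments computable1_input {R I} i.

Lemma leq_expn m n e : (m <= n)%N -> (m ^ e <= n ^ e)%N.
Proof. by case: e => // e mn; rewrite leq_exp2r. Qed.

(** * Multi-indices as multinomials, and their number *)

Section MultiIndex.
Context (d N : nat).

Definition multinom_of (a : multi_index d N) : multinom d.+1 :=
  Multinom [tuple (val a i : nat) | i < d.+1].

Lemma multinom_ofE a i : multinom_of a i = val a i.
Proof. by rewrite mnm_tnth tnth_mktuple. Qed.

Lemma mdeg_multinom_of a : mdeg (multinom_of a) = N.
Proof.
by rewrite mdegE -(eqP (valP a)); apply: eq_bigr => i _; rewrite multinom_ofE.
Qed.

Lemma multinom_of_inj : injective multinom_of.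
Proof.
move=> a b ab; apply/val_inj/ffunP => i; apply: val_inj => /=.
by rewrite -!multinom_ofE ab.
Qed.

Lemma multi_indexP m : mdeg m = N -> exists a, multinom_of a = m.
Proof.
move=> mN; have mi i : (m i < N.+1)%N.
  by rewrite ltnS -mN mdegE (bigD1 i) //= leq_addr.
pose f : {ffun 'I_d.+1 -> 'I_N.+1} := [ffun i => Ordinal (mi i)].
have aN : (\sum_i f i == N :> nat)%N.
  by rewrite -[X in _ == X]mN mdegE; apply/eqP/eq_bigr => i _; rewrite ffunE.
exists (exist (fun a : {ffun 'I_d.+1 -> 'I_N.+1} => \sum_i a i == N :> nat)%N f aN).
apply/mnmP => i.
by rewrite multinom_ofE ffunE.
Qed.

(** The component at [ord0] is determined by the [d] others, whence the exponent [d] instead of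
    [d.+1]. *)
Lemma card_multi_index : (#|multi_index d N| <= N.+1 ^ d)%N.
Proof.
pose f (a : multi_index d N) := [ffun i : 'I_d => val a (lift ord0 i)].
have f_inj : injective f.
  move=> a b /ffunP ab; apply/val_inj/ffunP => i.
  have abS j : val a (lift ord0 j) = val b (lift ord0 j) by have := ab j; rewrite !ffunE.
  case: (unliftP ord0 i) => [j|] -> //; apply: val_inj.
  have := eqP (valP a); rewrite -[RHS](eqP (valP b)) !big_ord_recl /=.
  by under eq_bigr => j _ do rewrite abS; move/addIn.
by have := leq_card f f_inj; rewrite card_ffun !card_ord.
Qed.

Definition multinoms : seq (multinom d.+1) :=
  [seq multinom_of a | a <- enum {: multi_index d N}].

Lemma size_multinoms : (size multinoms <= N.+1 ^ d)%N.
Proof. by rewrite size_map -cardE card_multi_index. Qed.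

Lemma mem_multinoms m : (m \in multinoms) = (mdeg m == N).
Proof.
apply/mapP/eqP => [[a _ ->]|]; first exact: mdeg_multinom_of.
by move=> /multi_indexP[a <-]; exists a; rewrite ?mem_enum.
Qed.

End MultiIndex.

(** * Bernstein coefficients as scaled coefficients of a form *)

Section BernsteinForm.
Context (R : realType) (d : nat).
Implicit Types F : mpoly d.+1 R.

Definition multinomial_coeff N (m : multinom d.+1) : R := N`!%:R / (mfact m)%:R.

Lemma multinomial_coeff_neq0 N m : multinomial_coeff N m != 0.
Proof.
rewrite mulf_neq0 ?invr_eq0 ?pnatr_eq0 -?lt0n ?fact_gt0 // prodn_gt0 // => i.
exact: fact_gt0.
Qed.

(** Programs exchange forms as functions on all multinomials; the entries of degree other than [N]
    are ignored. *)
Definition form N (y : multinom d.+1 -> R) : mpoly d.+1 R :=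
  \sum_(a : multi_index d N) y (multinom_of a) *: mpolyX R (multinom_of a).

Lemma form_homog N y : form N y \is N.-homog.
Proof.
by apply: rpred_sum => a _; rewrite rpredZ // dhomogX /= mdeg_multinom_of.
Qed.

Lemma mcoeff_form N y m : mcoeff m (form N y) = if mdeg m == N then y m else 0.
Proof.
case: ifPn => [/eqP/multi_indexP[a <-]|/dhomog_nemf_coeff->//]; last first.
  exact: form_homog.
rewrite raddf_sum (bigD1 a) //= mcoeffZ mcoeffX eqxx mulr1 big1 ?addr0 // => b ba.
by rewrite mcoeffZ mcoeffX (inj_eq (@multinom_of_inj _ _)) (negbTE ba) mulr0.
Qed.

Lemma form_mcoeff N F : F \is N.-homog -> form N (fun m => mcoeff m F) = F.
Proof.
move=> hF; apply/mpolyP => m; rewrite mcoeff_form; case: ifPn => // mN.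
by rewrite (dhomog_nemf_coeff hF).
Qed.

Lemma eq_form N y z : y =1 z -> form N y = form N z.
Proof. by move=> yz; apply: eq_bigr => a _; rewrite yz. Qed.

Definition bernstein_form N (c : multi_index d N -> R) : mpoly d.+1 R :=
  \sum_a c a *: (multinomial_coeff N (multinom_of a) *: mpolyX R (multinom_of a)).

Lemma bernstein_form_homog N (c : multi_index d N -> R) :
  bernstein_form c \is N.-homog.
Proof.
by apply: rpred_sum => a _; rewrite !rpredZ // dhomogX /= mdeg_multinom_of.
Qed.

Lemma mcoeff_bernstein_form N (c : multi_index d N -> R) a :
  mcoeff (multinom_of a) (bernstein_form c) =
  c a * multinomial_coeff N (multinom_of a).
Proof.
rewrite raddf_sum (bigD1 a) //= !mcoeffZ mcoeffX eqxx mulr1 big1 ?addr0 // => b ba.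
by rewrite !mcoeffZ mcoeffX (inj_eq (@multinom_of_inj _ _)) (negbTE ba) !mulr0.
Qed.

Lemma is_bernstein_coeffsE N p (c : multi_index d N -> R) :
  is_bernstein_coeffs p c <-> p = dehomogenize (bernstein_form c).
Proof.
rewrite /is_bernstein_coeffs; suff -> : dehomogenize (bernstein_form c) =
  \sum_a c a *: bernstein R a by [].
rewrite raddf_sum; apply: eq_bigr => a _ /=; rewrite [LHS]linearZ /=.
congr (_ *: _); rewrite [LHS]linearZ /= dehomogenizeX /multinomial_coeff.
by congr (_ / _%:R *: _); apply: eq_bigr => i _; rewrite multinom_ofE.
Qed.

End BernsteinForm.

(** * Programs for the lowering operator and Horner's scheme *)

Section FormPrograms.
Context (R : realType) (d : nat).
Local Notation X := (multinom d.+1).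
Implicit Types (Psi : mpoly d.+1 R -> mpoly d.+1 R).

Definition form_computable k K Psi :=
  computable k (fun (y : X -> R) m => mcoeff m (Psi (form K y))).

Lemma form_computable_comp k l K L Psi Psi' :
  (forall F, F \is K.-homog -> Psi F \is L.-homog) ->
  form_computable k K Psi -> form_computable l L Psi' ->
  form_computable (k + l) K (Psi' \o Psi).
Proof.
move=> hPsi cPsi cPsi'; apply: computable_leq (computable_comp _ cPsi cPsi') _ _ => //.
  by move=> y z yz m; rewrite (eq_form L yz).
by move=> y m /=; rewrite form_mcoeff //; exact/hPsi/form_homog.
Qed.

(** At most [K.+1 ^ d] coefficients, each a sum of [d.+1] terms that cost one multiplication by a
    constant and one addition. *)
Lemma form_computable_lowering K :
  form_computable (K.+1 ^ d * (d.+1 * 2)) K.+1 (@lowering d.+1 R).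
Proof.
have h m : computable1 (d.+1 * 2) (fun y : X -> R => mcoeff m (lowering (form K.+1 y))).
  apply: computable_leq (computable1_sum (index_enum 'I_d.+1) (k := 1)
    (a := fun i y => (m i).+1%:R ^+ 2 * mcoeff (mnm_add m (mnm1 i)) (form K.+1 y)) _) _ _.
  - move=> i; apply: (computable1M (k := 0) (l := 0)); first exact: computable1_const.
    apply: computable_leq (_ : computable1 0 (fun y : X -> R =>
      if mdeg (mnm_add m (mnm1 i)) == K.+1 then y (mnm_add m (mnm1 i)) else 0)) _ _ => //.
      by case: eqP => _; [exact: computable1_input | exact: computable1_const].
    by move=> y _; rewrite mcoeff_form.
  - by rewrite /index_enum -enumT size_enum_ord.
  - by move=> y _; rewrite mcoeff_lowering.
apply: computable_leq (computable_seq (s := multinoms d K) (fun m _ => h m) _) _ _ => //.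
  move=> y m; rewrite mem_multinoms; apply: dhomog_nemf_coeff.
  exact/lowering_homog/form_homog.
by rewrite leq_mul2r size_multinoms orbT.
Qed.

Lemma form_computable_iter_lowering j K N : (j + K <= N)%N ->
  form_computable (j * (N.+1 ^ d * (d.+1 * 2))) (j + K) (iter j (@lowering d.+1 R)).
Proof.
elim: j => [|j IH] jN.
  (* Even without lowering, the entries of the wrong degree have to be replaced by 0. *)
  apply: computable_leq (computable_reindex (fun m : X =>
    if mdeg m == K then inl m else inr 0) (computable_operand inl)) _ _ => //.
  by move=> y m /=; rewrite mcoeff_form; case: ifP.
rewrite mulSn; apply: computable_leq
  (form_computable_comp _ (form_computable_lowering (j + K)) (IH (ltnW jN))) _ _.
- exact: lowering_homog.
- by rewrite leq_add2r leq_mul2r leq_expn ?orbT // ltnW.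
- by move=> y m /=; rewrite -iterSr.
Qed.

(** Per level and coefficient, [D] costs [2 (d + 1)] and the combination [c 0 F + s (...)] costs
    [d + 3], together at most [5 (d + 1)]. *)
Lemma form_computable_horner K N c : (K <= N)%N ->
  form_computable (K.+1 * (N.+1 ^ d * (d.+1 * 5))) K (@horner_lowering d R K c).
Proof.
elim: K c => [|K IH] c KN.
  have h m : computable1 1 (fun y : X -> R => c 0%N * y m).
    apply: (computable1M (k := 0) (l := 0)); first exact: computable1_const.
    exact: computable1_input.
  apply: computable_leq (computable_seq (s := multinoms d 0)
    (f := fun y m => if mdeg m == 0%N then c 0%N * y m else 0) _ _) _ _.
  - move=> m; rewrite mem_multinoms => /eqP ->; rewrite eqxx; exact: h.
  - by move=> y m; rewrite mem_multinoms => /negbTE->.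
  - by rewrite mul1n leq_mul // (leq_trans (size_multinoms _ _)) // leq_expn.
  - by move=> y m; rewrite /= mcoeffZ mcoeff_form; case: eqP => //; rewrite mulr0.
pose Y := (X + X)%type.
(* The coefficients of [F] are kept beside the result of the inner levels, since the outer level
   combines both. *)
pose f (y : X -> R) : Y -> R := sum_input y (fun m => mcoeff m
  (horner_lowering K (fun j => c j.+1) (lowering (form K.+1 y)))).
have cf : computable (K.+1 ^ d * (d.+1 * 2) + K.+1 * (N.+1 ^ d * (d.+1 * 5))) f.
  have ch := form_computable_comp (@lowering_homog _ _ K)
    (form_computable_lowering K) (IH (fun j => c j.+1) (ltnW KN)).
  apply: computable_leq (computable_pair (computable_operand
    (fun m : X => inl m)) ch) _ _ => //.
pose g (z : Y -> R) (m : X) := if mdeg m == K.+1 then c 0%N * z (inl m) +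
  \sum_i if m i == 0%N then 0 else z (inr (mnm_sub m (mnm1 i))) else 0.
have cg : computable (K.+2 ^ d * (d.+1 + 2)) g.
  apply: computable_leq (computable_seq (s := multinoms d K.+1)
    (k := d.+1 + 2) (f := g) _ _) _ _ => //.
  - move=> m; rewrite mem_multinoms /g => /eqP ->; rewrite eqxx.
    have hmul : computable1 1 (fun z : Y -> R => c 0%N * z (inl m)).
      apply: (computable1M (k := 0) (l := 0)); first exact: computable1_const.
      exact: computable1_input.
    have hsum : computable1 d.+1 (fun z : Y -> R =>
        \sum_i if m i == 0%N then 0 else z (inr (mnm_sub m (mnm1 i)))).
      apply: computable_leq (computable1_sum (index_enum 'I_d.+1) (k := 0)
        (a := fun i z => if m i == 0%N then 0 else z (inr (mnm_sub m (mnm1 i)))) _)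
        _ _ => //.
        by move=> i; case: eqP => _; [exact: computable1_const | exact: computable1_input].
      by rewrite /index_enum -enumT size_enum_ord muln1.
    by apply: computable_leq (computable1D hmul hsum) _ _ => //; rewrite addn2.
  - by move=> z m; rewrite mem_multinoms /g => /negbTE->.
  - by rewrite leq_mul2r size_multinoms orbT.
apply: computable_leq (computable_comp _ cf cg) _ _.
- by move=> y z yz m; rewrite /g yz; under eq_bigr => i _ do rewrite yz.
- rewrite [X in (_ <= X)%N]mulSn addnAC leq_add2r.
  apply: (@leq_trans (N.+1 ^ d * (d.+1 * 2) + N.+1 ^ d * (d.+1 + 2))).
    by rewrite leq_add // leq_mul2r leq_expn ?orbT // ltnW.
  by rewrite -mulnDr leq_mul2l; apply/orP; right; lia.
- move=> y m; rewrite /g /f /=; case: ifPn => [/eqP mK|mK].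
    rewrite mcoeffD mcoeffZ mcoeff_form mK eqxx mcoeff_varsumM.
    by congr (_ + _); apply: eq_bigr => i _.
  rewrite (dhomog_nemf_coeff _ mK) //.
  exact/(@horner_lowering_homog _ _ K.+1 c)/form_homog.
Qed.

End FormPrograms.

(** * The program for the projected product *)

Section ProductProgram.
Context (R : realType) (d M N : nat).
Local Notation X := (multinom d.+1).
Local Notation J := (multi_index d N + multi_index d M)%type.

Lemma computable1_mcoeff_bernstein_form (m : X) :
  computable1 1 (fun x : J -> R => mcoeff m (bernstein_form (x \o inl))).
Proof.
have [/multi_indexP[a <-]|mN] := eqVneq (mdeg m) N.
  apply: computable_leq (computable1M (k := 0) (l := 0) (computable1_input (inl a))
    (computable1_const (multinomial_coeff R N (multinom_of a)))) _ _ => // x _.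
  by rewrite mcoeff_bernstein_form.
apply: computable_leq (computable1_const 0) _ _ => // x _.
by rewrite (dhomog_nemf_coeff _ mN) //; exact: bernstein_form_homog.
Qed.

(** Direct multiplication: each coefficient is a sum over the monomials of the second factor, whose
    number is bounded in terms of [d] and [M]. A term takes three multiplications and one addition,
    multinomial factors included. *)
Lemma computable_bernstein_product :
  computable ((M + N).+1 ^ d * (M.+1 ^ d * 4)) (fun (x : J -> R) m =>
    mcoeff m (bernstein_form (x \o inl) * bernstein_form (x \o inr))).
Proof.
pose t m (b : multi_index d M) (x : J -> R) :=
  (multinomial_coeff R M (multinom_of b) * x (inr b)) *
  (if mpoly.lem (multinom_of b) m
   then mcoeff (mnm_sub m (multinom_of b)) (bernstein_form (x \o inl)) else 0).
have ht m b : computable1 3 (t m b).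
  apply: (computable1M (k := 1) (l := 1)).
    apply: (computable1M (k := 0) (l := 0)); first exact: computable1_const.
    exact: computable1_input.
  case: (mpoly.lem _ m); first exact: computable1_mcoeff_bernstein_form.
  exact: computable_leq (computable1_const 0) (leq0n _) (fun _ _ => erefl).
have h m : computable1 (M.+1 ^ d * 4) (fun x : J -> R =>
    mcoeff m (bernstein_form (x \o inl) * bernstein_form (x \o inr))).
  apply: computable_leq (computable1_sum (index_enum (multi_index d M)) (ht m)) _ _.
    by rewrite /index_enum -enumT -cardE leq_mul2r card_multi_index orbT.
  move=> x _; rewrite [in RHS]/(bernstein_form (x \o inr)) mulr_sumr raddf_sum.
  apply: eq_bigr => b _; rewrite /= scalerA -scalerAr mcoeffZ mcoeffMX_lem.
  by rewrite [x _ * _]mulrC.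
apply: computable_leq (computable_seq (s := multinoms d (M + N))
  (fun m _ => h m) _) _ _ => //; last by rewrite leq_mul2r size_multinoms orbT.
move=> x m; rewrite mem_multinoms; apply: dhomog_nemf_coeff.
by rewrite addnC; apply: dhomogM; exact: bernstein_form_homog.
Qed.

(** The four summands of the cost are the product, the [M] lowerings, Horner's scheme, and the final
    multiplication by the inverse multinomial coefficients. *)
Lemma computable_projection_of_product (c : nat -> R) :
  computable ((M + N).+1 ^ d * (M.+1 ^ d * 4 + M * (d.+1 * 2) + N.+1 * (d.+1 * 5) + 1))
    (fun (x : J -> R) (a : multi_index d N) =>
       mcoeff (multinom_of a) (horner_lowering N c (iter M (@lowering d.+1 R)
         (bernstein_form (x \o inl) * bernstein_form (x \o inr)))) /
       multinomial_coeff R N (multinom_of a)).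
Proof.
have hM := form_computable_comp (@iter_lowering_homog _ _ M N)
  (form_computable_iter_lowering R d (leqnn (M + N)))
  (form_computable_horner d c (leq_addl M N)).
pose g (y : X -> R) (a : multi_index d N) :=
  y (multinom_of a) * (multinomial_coeff R N (multinom_of a))^-1.
have hg : computable ((M + N).+1 ^ d * 1) g.
  apply: computable_leq (computable_seq (s := enum {: multi_index d N}) (k := 1)
    (f := g) _ _) _ _ => //.
  - move=> a _; apply: (computable1M (k := 0) (l := 0)); first exact: computable1_input.
    exact: computable1_const.
  - by move=> y a; rewrite mem_enum.
  - rewrite -cardE leq_mul2r (leq_trans (card_multi_index _ _)) ?orbT //.
    by rewrite leq_expn // ltnS leq_addl.
apply: computable_leq (computable_comp _
  (computable_comp _ computable_bernstein_product hM) hg) _ _.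
- by move=> y z yz a; rewrite /g yz.
- by move=> y z yz m; rewrite (eq_form _ yz).
- move: (_ ^ d)%N (_ ^ d)%N => E1 E2.
  by rewrite !mulnDr [(M * _)%N]mulnCA [(N.+1 * _)%N]mulnCA !addnA.
- move=> x a; rewrite /g form_mcoeff // addnC.
  by apply: dhomogM; exact: bernstein_form_homog.
Qed.

End ProductProgram.

Theorem mainTheorem2 (d M : nat) (d_ge1 : (1 <= d)%N) :
  exists C : nat, forall (R : realType) (N : nat), (1 <= N)%N ->
  exists P : slp R (multi_index d N + multi_index d M)%type (multi_index d N),
    (slp_cost P <= C * N ^ d.+1)%N /\
    forall (u w : mpoly d R)
           (cu : multi_index d N -> R) (cw : multi_index d M -> R),
      polys N u -> polys M w ->
      is_bernstein_coeffs u cu -> is_bernstein_coeffs w cw ->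
      exists q : mpoly d R,
        is_L2_projection N (u * w) q /\
        is_bernstein_coeffs q (slp_eval P (sum_input cu cw)).
Proof.
(* For [N >= 1] one has [M + N + 1 <= (M + 2) N] and [N + 1 <= 2 N]; the other summands are bounded
   by their multiples by [N]. *)
exists ((M + 2) ^ d * (M.+1 ^ d * 4 + M * (d.+1 * 2) + 2 * (d.+1 * 5) + 1))%N.
(* The coefficients [c] are fixed before [u] and [w], so they enter the program as constants. *)
move=> R N N_gt0; have [c hc] := projection_coefficients d R M N.
have [P [Pcost Peval]] := computable_projection_of_product d M N c.
exists P; split.
  apply: (leq_trans Pcost); rewrite expnSr mulnACA -expnMn leq_mul //.
    by rewrite leq_expn //; nia.
  by move: (_ ^ d)%N => E; nia.
move=> u w cu cw _ _ /is_bernstein_coeffsE-> /is_bernstein_coeffsE->.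
set F := bernstein_form cu * bernstein_form cw.
have hF : F \is (M + N).-homog.
  by rewrite addnC; apply: dhomogM; exact: bernstein_form_homog.
have hQ : horner_lowering N c (iter M (@lowering d.+1 R) F) \is N.-homog.
  exact/horner_lowering_homog/iter_lowering_homog.
exists (dehomogenize (horner_lowering N c (iter M (@lowering d.+1 R) F))); split.
  rewrite -rmorphM -/F; apply: (is_L2_projection_dehomogenize hF hQ) => V hV.
  exact: hc.
(* The forms themselves agree: in degree [N] the division at the end of the program cancels the
   multinomial factor, and in other degrees both coefficients are 0. *)
apply/is_bernstein_coeffsE; congr dehomogenize; apply/mpolyP => m.
have [/multi_indexP[a <-]|mN] := eqVneq (mdeg m) N; last first.
  by rewrite !(dhomog_nemf_coeff _ mN) //; exact: bernstein_form_homog.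
by rewrite mcoeff_bernstein_form Peval divfK ?multinomial_coeff_neq0.
Qed.
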